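(* Let $\mathcal{C}\colon f(x,y)=0$ be a complex plane algebraic curve, where $$f(x,y)=\sum_{k=0}^n a_k(x)\,y^{n-k}$$ is a polynomial of degree $n$ in $y$ whose coefficients $a_k(x)$ are polynomials in $x$ with complex coefficients. Let $x_1\in\mathbb{C}$ be a point at which neither the leading coefficient $a_0(x)$ nor the discriminant of $f(x,y)$ with respect to $y$ vanishes. Then for every $\varepsilon>0$ one can algorithmically compute (from $f$, $x_1$ and $\varepsilon$) a number $\delta>0$ such that $$|y_j(x_1)-y_j(x_2)|<\varepsilon$$ for all holomorphic functions $y_j(x)$, $j=1,2,\dots,n$, that satisfy $f(x,y_j(x))=0$ in a neighbourhood of $x_1$, and for all $x_2\in\mathbb{C}$ with $|x_1-x_2|<\delta$.
   Context: Near $x_1$ there are exactly $n$ holomorphic function germs $y_1,\dots,y_n$ with $f(x,y_j(x))=0$ (the local branches of the curve over $x_1$). For $x_2$ with $|x_1-x_2|<\delta$, the value $y_j(x_2)$ is the one obtained by analytic continuation of $y_j$ along the segment from $x_1$ to $x_2$; it is part of the assertion that this continuation exists. ''Algorithmically compute'' is meant with respect to exact real/complex arithmetic, where the zeros of univariate complex polynomials are regarded as computable by a root-finding algorithm. *)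

(* Defs.v *)
From HB Require Import structures.
From mathcomp Require Import all_boot all_order all_algebra.
From mathcomp Require Import all_classical all_reals all_analysis.
From mathcomp Require Import complex.

Set Implicit Arguments.
Unset Strict Implicit.
Unset Printing Implicit Defensive.
Import Order.TTheory GRing.Theory Num.Theory numFieldNormedType.Exports.
Local Open Scope ring_scope.
Local Open Scope classical_set_scope.
Local Open Scope complex_scope.

(** A small typed language of Blum-Shub-Smale strength: exact field operations,
    conjugation, comparison of real parts, root finding, lists and unbounded
    loops.  The only machine constants are the integers and the imaginary unit,
    so no information can be hidden in a constant. *)

Inductive ty : Type :=
| TNum | TBool | TProd of ty & ty | TList of ty.

Inductive prog : ty -> ty -> Type :=
| Id A : prog A A
| Comp A B D : prog A B -> prog B D -> prog A D
| Fork A B D : prog A B -> prog A D -> prog A (TProd B D)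
| Fst A B : prog (TProd A B) A
| Snd A B : prog (TProd A B) B
| Const A : int -> prog A TNum
| Imag A : prog A TNum
| Add : prog (TProd TNum TNum) TNum
| Opp : prog TNum TNum
| Mul : prog (TProd TNum TNum) TNum
| Inv : prog TNum TNum
| Conj : prog TNum TNum
| Roots : prog (TList TNum) (TList TNum)
| Le : prog (TProd TNum TNum) TBool
| If A B : prog A TBool -> prog A B -> prog A B -> prog A B
| Nil A B : prog A (TList B)
| Cons A : prog (TProd A (TList A)) (TList A)
| Case A B D : prog A D -> prog (TProd A (TProd B (TList B))) D ->
    prog (TProd A (TList B)) D
| While A : prog A TBool -> prog A A -> prog A A.

Fixpoint interp (T : Type) (A : ty) : Type :=
  match A with
  | TNum => T
  | TBool => bool
  | TProd A B => (interp T A * interp T B)%type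
  | TList A => seq (interp T A)
  end.

Inductive loop (T : Type) (test : T -> bool -> Prop) (body : T -> T -> Prop) :
  T -> T -> Prop :=
| loop_stop x : test x false -> loop test body x x
| loop_step x y z :
    test x true -> body x y -> loop test body y z -> loop test body x z.

Section Semantics.
Variable R : realType.

(** Lists of coefficients start with the constant term. The zeros come with
    multiplicity, in an order about which nothing is assumed. *)
Definition root_finder (rt : seq R[i] -> seq R[i]) : Prop :=
  forall s : seq R[i], Poly s != 0 ->
    Poly s = lead_coef (Poly s) *: \prod_(z <- rt s) ('X - z%:P).

Lemma root_finder_exists : exists rt, root_finder rt.
Proof.
exists (fun s => sval (closed_field_poly_normal (Poly s))) => s _.
exact: svalP (closed_field_poly_normal (Poly s)).
Qed.

Variable rt : seq R[i] -> seq R[i].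

(** [computes p x y]: on input [x], [p] halts with output [y].  Inverting zero
    and asking for the zeros of the zero polynomial yield no output. *)
Fixpoint computes A B (p : prog A B) :
    interp R[i] A -> interp R[i] B -> Prop :=
  match p in prog A B return interp R[i] A -> interp R[i] B -> Prop with
  | Id _ => fun x y => y = x
  | Comp _ _ _ p q => fun x y => exists2 z, computes p x z & computes q z y
  | Fork _ _ _ p q => fun x y => computes p x y.1 /\ computes q x y.2
  | Fst _ _ => fun x y => y = x.1
  | Snd _ _ => fun x y => y = x.2
  | Const _ k => fun _ y => y = k%:~R
  | Imag _ => fun _ y => y = 'i
  | Add => fun x y => y = x.1 + x.2
  | Opp => fun x y => y = - x
  | Mul => fun x y => y = x.1 * x.2
  | Inv => fun x y => x != 0 /\ y = x^-1
  | Conj => fun x y => y = x^*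
  | Roots => fun s t => Poly s != 0 /\ t = rt s
  | Le => fun x b => b = (complex.Re x.1 <= complex.Re x.2)
  | If _ _ c p q => fun x y => exists2 b, computes c x b &
      if b then computes p x y else computes q x y
  | Nil _ _ => fun _ s => s = [::]
  | Cons _ => fun x s => s = x.1 :: x.2
  | Case _ _ _ p q => fun x y =>
      if x.2 is h :: s then computes q (x.1, (h, s)) y else computes p x.1 y
  | While _ c p => loop (computes c) (computes p)
  end.

Lemma computes_det A B (p : prog A B) x y z :
  computes p x y -> computes p x z -> y = z.
Proof.
elim: p x y z => {A B} /=;
  try by [move=> *; congruence | move=> ? ? ? ? ? [? ->] [? ->]
         | move=> ? ? ? [? ->] [? ->]].
- move=> A B D p IHp q IHq x y z [u pu qu] [v pv qv].
  by move: qv; rewrite -(IHp _ _ _ pu pv); apply: IHq.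
- move=> A B D p IHp q IHq x [y1 y2] [z1 z2] /= [p1 q1] [p2 q2].
  by rewrite (IHp _ _ _ p1 p2) (IHq _ _ _ q1 q2).
- move=> A B c IHc p IHp q IHq x y z [b cb pb] [b' cb'].
  by rewrite -(IHc _ _ _ cb cb'); case: b pb {cb} => ?; [apply: IHp|apply: IHq].
- by move=> A B D p IHp q IHq [x [|h s]] y z /=; [apply: IHp|apply: IHq].
- move=> A c IHc p IHp x y z xy; elim: xy z => {x y} [x cx|x u y cx pxu _ IH] z.
    move=> xz; case: z / xz cx => // x' u z cx' _ _ cx.
    by have := IHc _ _ _ cx cx'.
  move=> xz; case: z / xz cx pxu => [x' cx'|x' u' z cx' px'u' u'z] cx pxu.
    by have := IHc _ _ _ cx cx'.
  by apply: IH; rewrite (IHp _ _ _ pxu px'u').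
Qed.

End Semantics.

(** [f : {poly {poly K}}] is a polynomial in [y] over [K[x]]: the coefficient
    [a_k(x)] of [y^(n-k)] is [f`_(n - k)], with [n = (size f).-1]. *)

Definition curve_eval (K : nzRingType) (f : {poly {poly K}}) (x y : K) : K :=
  f.[y%:P].[x].

(** In characteristic zero the leading coefficient divides [resultant f f^`()]
    when [f] has positive degree in [y], so the division is exact. *)
Definition discriminant_y (K : fieldType) (f : {poly {poly K}}) : {poly K} :=
  ((-1) ^+ 'C((size f).-1, 2) * resultant f f^`()) %/ lead_coef f.

Section Continuation.
Variable R : realType.
Implicit Types (g y : R[i] -> R[i]) (x : R[i]).

(* [R[i]^o] is [R[i]] with its topology, as a normed space over itself: [g] is
   complex differentiable at all points near [x]. *)
Definition holomorphic_near g x : Prop :=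
  \forall z \near (x : R[i]^o), derivable (g : R[i]^o -> R[i]^o) z 1.

Definition same_germ g y x : Prop :=
  \forall z \near (x : R[i]^o), g z = y z.

(** [g t] represents the germ at [gamma t] of a continuation of [y] along
    [gamma], for [t] in [[0, 1]]. *)
Definition analytic_continuation (gamma : R -> R[i]) y
    (g : R -> R[i] -> R[i]) : Prop :=
  [/\ same_germ (g 0) y (gamma 0),
      forall t : R, 0 <= t <= 1 -> holomorphic_near (g t) (gamma t) &
      forall t : R, 0 <= t <= 1 -> \forall s \near t,
        0 <= s <= 1 -> same_germ (g s) (g t) (gamma s)].

Definition segment (x1 x2 : R[i]) (t : R) : R[i] := x1 + t%:C * (x2 - x1).

End Continuation.

(* Main.v *)
Require Import Defs.
From HB Require Import structures.
From mathcomp Require Import all_boot all_order all_algebra.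
From mathcomp Require Import separable.
From mathcomp Require Import all_classical all_reals all_analysis.
From mathcomp Require Import complex ring.

Set Implicit Arguments.
Unset Strict Implicit.
Unset Printing Implicit Defensive.
Import Order.TTheory GRing.Theory Num.Theory numFieldNormedType.Exports.
Local Open Scope ring_scope.
Local Open Scope complex_scope.

(** Why the theorem holds.  Let z be the list of the n roots of f(x1, Y); the
    discriminant makes them distinct.  Choose a radius r <= eps so small that
    the discs of radius r around the roots are pairwise disjoint.  If x is
    close to x1, then f(x, c) is small for every c in z, because f(x1, c) = 0.
    Since f(x, c) = a_0(x) * prod_w (c - w), the product ranging over the n
    roots w of f(x, Y), the inequality |f(x, c)| < |a_0(x)| * r ^ n forces some
    w to lie within r of c [exists_root_near].  There are as many disjoint
    discs as roots, so each disc contains exactly one root, and it is simple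
    [roots_matching].  Call Y_c(x) the root in the disc around c.

    This Y_c is defined on the whole disc |x - x1| < delta.  It is continuous,
    because the same product argument, applied at another base point and with
    a smaller radius, shows that roots persist [root_persists]; it is complex
    differentiable by implicit differentiation, done algebraically with
    divided differences [implicit_derivable].  A germ y with y(x1) = c stays
    in the disc around c near x1, so it coincides with Y_c there, and the
    constant family Y_c is its continuation along every segment issued from x1
    inside the disc.  It moves by less than r <= eps.

    The requirement on x is |x - x1| * M * r ^ -n < |a_0(x)|, where M bounds
    the Lipschitz constants at x1 of the polynomials f(., c).  Both r and M can
    be written with sums, products, inverses and the squares |c| ^ 2 = c * c^*
    only: |t| <= 1 + |t| ^ 2 replaces square roots, and an inverse of a sum of
    inverses replaces a minimum.  The result is the closed formula
    [delta_bound].  It is computed by a program because the functions computed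
    by programs that always halt are closed under arithmetic, guarded
    inversion, guarded root finding and folds over lists [computable_foldl]. *)

(** * Location of the roots of a perturbed polynomial *)

Section RootLocation.
Variable K : numClosedFieldType.
Implicit Types (p : {poly K}) (z : seq K).

(** If all roots were at distance at least r from c, the product formula would
    give |p(c)| >= |lead_coef p| * r ^ deg p. *)
Lemma exists_root_near p (c r : K) : 0 <= r ->
  `|p.[c]| < `|lead_coef p| * r ^+ (size p).-1 ->
  exists2 w, root p w & `|c - w| < r.
Proof.
move=> r0; have [->|pn0] := eqVneq p 0.
  by rewrite horner0 lead_coef0 !normr0 mul0r ltxx.
have [ws pE] := closed_field_poly_normal p.
have szp : (size p).-1 = size ws.
  by rewrite pE size_scale ?lead_coef_eq0// size_prod_XsubC.
have [/hasP[w wws cw] _|/hasPn far] := boolP (has (fun w => `|c - w| < r) ws).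
  by exists w; rewrite // pE rootZ ?lead_coef_eq0// root_prod_XsubC.
suff /le_lt_trans H : `|lead_coef p| * r ^+ (size p).-1 <= `|p.[c]|.
  by move=> /H; rewrite ltxx.
rewrite szp {2}pE hornerZ normrM ler_wpM2l// horner_prod.
rewrite [X in `|X|](eq_bigr (fun w => c - w)); last first.
  by move=> w _; rewrite hornerXsubC.
have -> : r ^+ size ws = \prod_(w <- ws) r.
  by rewrite big_const_seq count_predT -Monoid.iteropE.
rewrite normr_prod [X in _ <= X]big_seq big_seq ler_prod// => w /far.
by rewrite r0/= -real_leNgt ?normr_real// ger0_real.
Qed.

(** Pigeonhole: the discs around the deg p points of z are disjoint and each
    contains a root, so phi, which picks a root in each disc, is a bijection
    from z onto the roots.  Hence the roots are distinct and no disc contains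
    two of them. *)
Lemma roots_matching p z (r : K) : 0 <= r -> p != 0 ->
    size z = (size p).-1 -> uniq z ->
    {in z &, forall a b : K, a != b -> r + r <= `|a - b|} ->
    {in z, forall a, `|p.[a]| < `|lead_coef p| * r ^+ (size p).-1} ->
  exists phi : K -> K, [/\ {in z, forall a, `|a - phi a| < r},
    {in z, forall a b, root p b -> `|a - b| < r -> b = phi a} &
    coprimep p p^`()].
Proof.
move=> r0 pn0 szz uz sep small.
have [ws pE] := closed_field_poly_normal p.
have rootE w : root p w = (w \in ws).
  by rewrite pE rootZ ?lead_coef_eq0// root_prod_XsubC.
have szp : (size p).-1 = size ws.
  by rewrite pE size_scale ?lead_coef_eq0// size_prod_XsubC.
pose near (a w : K) := `|a - w| < r.
pose phi (a : K) := nth 0 ws (find (near a) ws).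
have phiP a : a \in z -> has (near a) ws.
  move=> az; have [w rw aw] := exists_root_near r0 (small a az).
  by apply/hasP; exists w; rewrite -?rootE.
have phi_near a : a \in z -> `|a - phi a| < r.
  by move=> /phiP; exact: nth_find.
have phi_mem a : a \in z -> phi a \in ws.
  by move=> /phiP; rewrite has_find; exact: mem_nth.
have close a b w : a \in z -> b \in z -> `|a - w| < r -> `|b - w| < r -> a = b.
  move=> az bz aw bw; apply/eqP/negP => /negP/(sep a b az bz) /le_lt_trans H.
  suff /H : `|a - b| < r + r by rewrite ltxx.
  rewrite -(subrK w a) -addrA; apply: le_lt_trans (ler_normD _ _) _.
  by rewrite ltrD// -normrN opprB.
have phi_inj : {in z &, injective phi}.
  move=> a b az bz ab; apply: (close a b (phi a)) => //; first exact: phi_near.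
  by rewrite ab; exact: phi_near.
have uphi : uniq (map phi z) by rewrite map_inj_in_uniq.
have sub : {subset map phi z <= ws} by move=> _ /mapP[a /phi_mem ? ->].
have szphi : (size ws <= size (map phi z))%N by rewrite size_map szz szp.
have [_ ewz] := uniq_min_size uphi sub szphi.
have uws : uniq ws by rewrite (leq_size_uniq uphi sub szphi).
exists phi; split=> //; last first.
  rewrite pE derivZ coprimepZl ?coprimepZr ?lead_coef_eq0//.
  by have := separable_prod_XsubC ws; rewrite uws unlock.
move=> a az b; rewrite rootE -ewz => /mapP[c cz ->] ac.
by rewrite (close _ _ _ az cz ac) //; exact: phi_near.
Qed.

End RootLocation.

(** * Explicit Lipschitz bounds for polynomials *)

Section Majorant.
Variable K : numFieldType.
Implicit Types (x z : K).

Lemma norm_double_le x : `|x| + `|x| <= 1 + `|x| ^+ 2.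
Proof.
rewrite -subr_ge0; suff -> : 1 + `|x| ^+ 2 - (`|x| + `|x|) = (1 - `|x|) ^+ 2.
  by rewrite real_exprn_even_ge0// rpredB ?normr_real.
by ring.
Qed.

Lemma norm_le_add1sqr x : `|x| <= 1 + `|x| ^+ 2.
Proof. by apply: le_trans (norm_double_le x); rewrite lerDl. Qed.

(** The polynomial with coefficients 1 + |c| ^ 2 >= |c|, evaluated at a point
    that is at least 1 + |x1|. *)
Definition majorant (x1 : K) (s : seq K) : K :=
  horner_rec [seq 1 + `|c| ^+ 2 | c <- s] (1 + (1 + `|x1| ^+ 2)).

Lemma majorant_cons x1 c s : majorant x1 (c :: s) =
  majorant x1 s * (1 + (1 + `|x1| ^+ 2)) + (1 + `|c| ^+ 2).
Proof. by []. Qed.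

Lemma horner_rec_ge0 (s : seq K) x :
  0 <= x -> {in s, forall c, 0 <= c} -> 0 <= horner_rec s x.
Proof.
move=> x0; elim: s => //= c s IH sP; rewrite addr_ge0 ?mulr_ge0 ?IH//.
  by move=> d ds; rewrite sP// inE ds orbT.
by rewrite sP ?mem_head.
Qed.

Lemma add1sqr_ge0 x : 0 <= 1 + `|x| ^+ 2.
Proof. by rewrite addr_ge0 ?exprn_ge0. Qed.

Lemma majorant_ge0 x1 s : 0 <= majorant x1 s.
Proof.
rewrite /majorant horner_rec_ge0 ?addr_ge0 ?add1sqr_ge0//.
by move=> _ /mapP[c _ ->]; exact: add1sqr_ge0.
Qed.

(** The evaluation point 1 + (1 + |x1| ^ 2) serves both bounds at once: it
    exceeds |x|, and the Horner step
    x p(x) - x1 p(x1) = (x - x1) p(x) + x1 (p(x) - p(x1))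
    multiplies the bound by 1 + |x1|. *)
Lemma majorantP x1 x (s : seq K) : `|x - x1| <= 1 ->
  `|horner_rec s x| <= majorant x1 s /\
  `|horner_rec s x - horner_rec s x1| <= `|x - x1| * majorant x1 s.
Proof.
move=> xx1; elim: s => [|c s [IH1 IH2]] /=.
  by rewrite /majorant/= subrr normr0 mulr0.
have xB : `|x| <= 1 + (1 + `|x1| ^+ 2).
  rewrite -(subrK x1 x); apply: le_trans (ler_normD _ _) _.
  by rewrite lerD// norm_le_add1sqr.
split.
  rewrite majorant_cons.
  apply: le_trans (ler_normD _ _) _; rewrite lerD ?norm_le_add1sqr//.
  by rewrite normrM ler_pM.
rewrite opprD addrACA subrr addr0.
have -> : horner_rec s x * x - horner_rec s x1 * x1 =
   horner_rec s x * (x - x1) + (horner_rec s x - horner_rec s x1) * x1.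
  by rewrite mulrBr mulrBl addrA subrK.
apply: le_trans (ler_normD _ _) _.
rewrite !normrM majorant_cons.
rewrite [X in _ <= X]mulrDr ler_wpDr ?mulr_ge0 ?add1sqr_ge0//.
rewrite mulrDr mulr1 mulrDr [`|_ s x| * _]mulrC lerD ?ler_wpM2l//.
by rewrite mulrA ler_pM ?norm_le_add1sqr.
Qed.

Definition majorant2 (x1 : K) (f : seq (seq K)) z : K :=
  horner_rec [seq majorant x1 a | a <- f] (1 + `|z| ^+ 2).

Lemma majorant2_cons x1 a f z : majorant2 x1 (a :: f) z =
  majorant2 x1 f z * (1 + `|z| ^+ 2) + majorant x1 a.
Proof. by []. Qed.

Lemma majorant2_ge0 x1 f z : 0 <= majorant2 x1 f z.
Proof.
rewrite /majorant2 horner_rec_ge0 ?add1sqr_ge0//.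
by move=> _ /mapP[c _ ->]; exact: majorant_ge0.
Qed.

Lemma majorant2P x1 x (f : seq (seq K)) z : `|x - x1| <= 1 ->
  `|horner_rec [seq horner_rec a x | a <- f] z -
    horner_rec [seq horner_rec a x1 | a <- f] z|
  <= `|x - x1| * majorant2 x1 f z.
Proof.
move=> xx1; elim: f => [|a f IH] /=.
  by rewrite /majorant2/= subrr normr0 mulr0.
rewrite opprD addrACA -mulrBl.
apply: le_trans (ler_normD _ _) _.
rewrite majorant2_cons.
rewrite mulrDr lerD ?(majorantP a xx1).2//.
by rewrite normrM mulrA ler_pM ?norm_le_add1sqr.
Qed.

End Majorant.

(** * The polynomial in y above a point of the x-line *)

Section Fiber.
Variable K : fieldType.
Implicit Types (f : {poly {poly K}}) (x y : K).

Definition fiber f x : {poly K} := map_poly (horner_eval x) f.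

Lemma fiberE f x : fiber f x = Poly [seq a.[x] | a <- f].
Proof. by rewrite /fiber map_polyE. Qed.

Lemma curve_evalE f x y :
  curve_eval f x y = horner_rec [seq a.[x] | a <- f] y.
Proof.
have -> : curve_eval f x y = (horner_rec f y%:P).[x] by [].
elim: (polyseq f) => [|a s IH] /=; first by rewrite horner0.
by rewrite hornerD hornerM hornerC IH.
Qed.

Lemma fiber_horner f x y : (fiber f x).[y] = curve_eval f x y.
Proof. by rewrite fiberE horner_Poly curve_evalE. Qed.

Lemma deriv_fiber f x : (fiber f x)^`() = fiber f^`() x.
Proof. by rewrite /fiber deriv_map. Qed.

Lemma size_fiber f x : (lead_coef f).[x] != 0 -> size (fiber f x) = size f.
Proof. by move=> a0; exact: size_map_poly_id0. Qed.

Lemma lead_coef_fiber f x :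
  (lead_coef f).[x] != 0 -> lead_coef (fiber f x) = (lead_coef f).[x].
Proof. by move=> a0; exact: lead_coef_map_id0 (horner0 x) a0. Qed.

End Fiber.

(** * Nonvanishing discriminant and simple roots *)

Section Discriminant.
Variable K : numFieldType.
Implicit Type f : {poly {poly K}}.

Lemma deriv_coef_top f : (1 < size f)%N ->
  f^`()`_(size f).-2 = (size f).-1%:R *: lead_coef f.
Proof.
move=> sz; rewrite coef_deriv lead_coefE scaler_nat.
by case: (size f) sz => [|[]].
Qed.

Lemma deriv_coef_top_neq0 f : (1 < size f)%N -> f^`()`_(size f).-2 != 0.
Proof.
move=> sz; rewrite deriv_coef_top// scaler_eq0 pnatr_eq0 negb_or.
by rewrite -lt0n -ltnS prednK ?sz ?lead_coef_eq0 -?size_poly_gt0 ltnW.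
Qed.

Lemma size_deriv f : (1 < size f)%N -> size f^`() = (size f).-1.
Proof.
move=> sz; have f0 : f != 0 by rewrite -size_poly_gt0 ltnW.
apply/eqP; rewrite eqn_leq -ltnS prednK ?lt_size_deriv ?size_poly_gt0//=.
rewrite -(prednK (_ : 0 < (size f).-1)%N) ?ltn_predRL// ltnNge.
by apply: contra (deriv_coef_top_neq0 sz) => /leq_sizeP ->.
Qed.

Lemma lead_coef_deriv f : (1 < size f)%N ->
  lead_coef f^`() = (size f).-1%:R *: lead_coef f.
Proof. by move=> sz; rewrite lead_coefE size_deriv// deriv_coef_top. Qed.

Lemma lead_coef_dvd_coef f i : ((size f).-1 <= i)%N -> lead_coef f %| f`_i.
Proof.
rewrite leq_eqVlt => /predU1P[<-|]; first by rewrite lead_coefE.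
move=> lti; rewrite nth_default ?dvdp0//.
by case: (size f) lti.
Qed.

(** In the last column of the Sylvester matrix the only nonzero entries are the
    top coefficients of f and of f^`(), and these are multiples of the leading
    coefficient. *)
Lemma lead_coef_dvd_resultant f :
  (1 < size f)%N -> lead_coef f %| resultant f f^`().
Proof.
move=> sz; have szf' := size_deriv sz.
have f'dvd i : ((size f^`()).-1 <= i)%N -> lead_coef f %| f^`()`_i.
  rewrite szf' coef_deriv -scaler_nat => le_i.
  rewrite dvdpZr ?pnatr_eq0// lead_coef_dvd_coef//.
  by case: (size f) sz le_i => [|[]].
rewrite /resultant.
have d_gt0 : (0 < (size f^`()).-1 + (size f).-1)%N.
  by rewrite addn_gt0 orbC ltn_predRL sz.
pose j := Ordinal (etrans (congr1 (leq^~ _) (prednK d_gt0)) (leqnn _)).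
rewrite (expand_det_col _ j).
apply: (big_ind (fun p => lead_coef f %| p)) => [|p q|i _].
- exact: dvdp0.
- exact: dvdp_add.
rewrite dvdp_mulr// Sylvester_mxE; case: splitP => k _.
  have le_k : (k <= j)%N.
    by rewrite -ltnS /= prednK// (leq_trans (ltn_ord k)) ?leq_addr.
  rewrite le_k mulr1n lead_coef_dvd_coef// leq_subRL//=.
  by rewrite -ltnS prednK// ltn_add2r.
have le_k : (k <= j)%N.
  by rewrite -ltnS /= prednK// (leq_trans (ltn_ord k)) ?leq_addl.
rewrite le_k mulr1n f'dvd// leq_subRL//=.
by rewrite -ltnS prednK// addnC ltn_add2l.
Qed.

(** The division in the discriminant is exact, so the resultant does not vanish
    at x; as a_0(x) != 0, it specializes to the resultant of the fiber. *)
Lemma fiber_separable f x :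
  (1 < size f)%N -> (lead_coef f).[x] != 0 -> (discriminant_y f).[x] != 0 ->
  coprimep (fiber f x) (fiber f x)^`().
Proof.
move=> sz a0 disc.
have : (resultant f f^`()).[x] != 0.
  apply: contra disc => /eqP res0; rewrite /discriminant_y.
  have /dvdpP[d dE] := lead_coef_dvd_resultant sz.
  move: res0; rewrite dE => /eqP; rewrite hornerM mulf_eq0 (negPf a0) orbF.
  rewrite mulrA mulpK; last by apply: contraNneq a0 => ->; rewrite horner0.
  by rewrite hornerM => /eqP->; rewrite mulr0.
have -> : (resultant f f^`()).[x] = resultant (fiber f x) (fiber f x)^`().
  rewrite deriv_fiber -[LHS]/(horner_eval x _) map_resultant//=.
  rewrite lead_coef_deriv// /horner_eval hornerZ mulf_neq0// pnatr_eq0.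
  by rewrite -lt0n ltn_predRL.
rewrite resultant_eq0 -leqNgt /coprimep => le1.
rewrite eqn_leq le1 size_poly_gt0 gcdp_eq0 negb_and.
by rewrite -size_poly_gt0 size_fiber// ltnW.
Qed.

End Discriminant.

(** * Implicit differentiation *)

Section ImplicitDerivative.
Variable K : numFieldType.
Implicit Types (f : {poly {poly K}}) (x y : K).

Lemma curve_evalMXaddC f (c : {poly K}) x y :
  curve_eval (f * 'X + c%:P) x y = curve_eval f x y * y + c.[x].
Proof. by rewrite /curve_eval hornerMXaddC hornerD hornerM hornerC. Qed.

Lemma curve_eval_divided_difference f x0 : exists g, forall x y,
  curve_eval f x y - curve_eval f x0 y = (x - x0) * curve_eval g x y.
Proof.
elim/poly_ind: f => [|f c [g gP]].
  by exists 0 => x y; rewrite /curve_eval !horner0 subrr mulr0.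
have : root (c - c.[x0]%:P) x0 by rewrite rootE hornerD hornerN hornerC subrr.
move=> /factor_theorem[d dE]; exists (g * 'X + d%:P) => x y.
rewrite !curve_evalMXaddC opprD addrACA -mulrBl gP mulrDr mulrA; congr (_ + _).
have := congr1 (horner^~ x) dE; rewrite hornerD hornerN hornerC => ->.
by rewrite hornerM hornerXsubC mulrC.
Qed.

Lemma horner_divided_difference (p : {poly K}) w : exists2 q : {poly K},
  forall y, p.[y] - p.[w] = (y - w) * q.[y] & q.[w] = p^`().[w].
Proof.
have : root (p - p.[w]%:P) w by rewrite rootE hornerD hornerN hornerC subrr.
move=> /factor_theorem[q qE]; exists q => [y|].
  have := congr1 (horner^~ y) qE; rewrite hornerD hornerN hornerC => ->.
  by rewrite hornerM hornerXsubC mulrC.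
have := congr1 (fun p => p^`().[w]) qE.
rewrite derivB derivC subr0 derivM derivXsubC mulr1 hornerD hornerM.
by rewrite hornerXsubC subrr mulr0 add0r.
Qed.

Lemma near_disc (x1 x0 : K^o) (d : K) : `|x0 - x1| < d ->
  \forall x \near x0, `|x - x1| < d.
Proof.
move=> x0d; have cB := @cvgB K K^o _ _ (nbhs_filter x0) id (fun=> x1) _ _
  (@cvg_id _ (nbhs x0)) (@cst_continuous _ _ x1 x0).
exact: (cvgr_norm_lt _ cB _ x0d).
Qed.

Lemma continuous_affine (u v w : K^o -> K^o) (x0 : K^o) :
  {for x0, continuous u} -> {for x0, continuous v} -> {for x0, continuous w} ->
  {for x0, continuous (fun x => u x * v x + w x : K^o)}.
Proof.
move=> cu cv cw; have cuv := @cvgM K _ _ (nbhs_filter x0) u v _ _ cu cv.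
exact: (@cvgD K K^o _ _ (nbhs_filter x0) (u \* v) w _ _ cuv cw).
Qed.

Lemma horner_continuous (p : {poly K}) :
  continuous (fun x : K^o => p.[x] : K^o).
Proof.
move=> x0; elim/poly_ind: p => [|p c IH].
  rewrite (_ : (fun _ => _) = (fun=> 0)); first exact: cst_continuous.
  by apply/funext => x; rewrite horner0.
rewrite (_ : (fun _ => _) = (fun x => p.[x] * x + c)).
  apply: (@continuous_affine (fun x => p.[x]) id (fun=> c)).
  - exact: IH.
  - exact: (@cvg_id _ (nbhs x0)).
  - exact: cst_continuous.
by apply/funext => x; rewrite hornerMXaddC.
Qed.

Lemma continuous_curve_eval f (Y : K^o -> K^o) (x0 : K^o) :
  {for x0, continuous Y} ->
  {for x0, continuous (fun x : K^o => curve_eval f x (Y x) : K^o)}.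
Proof.
move=> cY; elim/poly_ind: f => [|f c IH].
  rewrite (_ : (fun _ => _) = (fun=> 0)); first exact: cst_continuous.
  by apply/funext => x; rewrite /curve_eval !horner0.
rewrite (_ : (fun _ => _) = (fun x => curve_eval f x (Y x) * Y x + c.[x])).
  apply: (@continuous_affine (fun x => curve_eval f x (Y x)) Y) => //.
  exact: horner_continuous.
by apply/funext => x; rewrite curve_evalMXaddC.
Qed.

(** Write f(x, y) - f(x0, y) = (x - x0) g(x, y) and
    f(x0, y) - f(x0, Y x0) = (y - Y x0) q(y).  With f(x, Y x) = 0 the difference
    quotient of Y equals - g(x, Y x) / q(Y x), which is continuous at x0 because
    q(Y x0) is the derivative of f(x0, .) at Y x0. *)
Lemma implicit_derivable f (Y : K^o -> K^o) (x0 : K^o) :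
  {for x0, continuous Y} ->
  (\forall x \near x0, curve_eval f x (Y x) = 0) ->
  curve_eval f^`() x0 (Y x0) != 0 ->
  derivable Y x0 1.
Proof.
move=> cY Y0 fy.
have [g gP] := curve_eval_divided_difference f x0.
have [q qP qw] := horner_divided_difference (fiber f x0) (Y x0).
have Yx0 : curve_eval f x0 (Y x0) = 0 by exact: nbhs_singleton Y0.
have cq : {for x0, continuous (fun x : K^o => q.[Y x] : K^o)}.
  by apply: continuous_comp => //; exact: horner_continuous.
have q0 : q.[Y x0] != 0 by rewrite qw deriv_fiber fiber_horner.
have to_x0 :
    ((fun h : K^o => h *: (1 : K^o) + x0) @ (0 : K^o)^' --> x0)%classic.
  have : {for (0 : K^o), continuous (fun h : K^o => h * 1 + x0 : K^o)}.
    apply: (@continuous_affine id (fun=> 1) (fun=> x0)).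
    - exact: (@cvg_id _ (nbhs (0 : K^o))).
    - exact: cst_continuous.
    - exact: cst_continuous.
  rewrite /prop_for /continuous_at mul0r add0r; apply: cvg_trans.
  by apply: cvg_app; exact: nbhs_dnbhs.
apply/cvg_ex; exists (- curve_eval g x0 (Y x0) / q.[Y x0]).
have : ((fun x : K^o => - curve_eval g x (Y x) / q.[Y x] : K^o) @ x0 -->
    (- curve_eval g x0 (Y x0) / q.[Y x0] : K^o))%classic.
  have cg := @cvgN K K^o _ _ (nbhs_filter x0) _ _
    (@continuous_curve_eval g _ _ cY).
  have cqV := @cvgV K _ _ (nbhs_filter x0) _ _ q0 cq.
  exact: (@cvgM K _ _ (nbhs_filter x0) _ _ _ _ cg cqV).
move=> /(cvg_comp _ _ to_x0); apply: cvg_trans; apply: near_eq_cvg.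
near=> h.
have h0 : h != 0 by near: h; exact: nbhs_dnbhs_neq.
have [Yx qx] : curve_eval f (h *: (1 : K^o) + x0) (Y (h *: (1 : K^o) + x0)) = 0
    /\ q.[Y (h *: (1 : K^o) + x0)] != 0.
  split; near: h; first exact: to_x0 Y0.
  by apply: (to_x0 [set x | q.[Y x] != 0]%classic); exact: cvgr_neq0 cq q0.
rewrite /=; set x := h *: _ + x0 in Yx qx *.
have xh : x - x0 = h by rewrite /x addrK [_ *: _]mulr1.
apply: (mulfI h0); apply: (mulIf qx).
rewrite -[_ *: _]/(h^-1 * _) mulVKf// -[LHS]mulrA divfK// mulrN -{1}xh.
by rewrite -gP Yx sub0r opprK -qP !fiber_horner Yx0 subr0.
Unshelve. all: by end_near. Qed.

End ImplicitDerivative.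

(** * Persistence of roots and local branches *)

Section Branch.
Variable K : numClosedFieldType.
Implicit Types (f : {poly {poly K}}).

(** f(x, w) tends to f(x0, w) = 0 while |a_0(x)| stays above half of its value
    at x0, so [exists_root_near] applies for x near x0. *)
Lemma root_persists f (x0 : K^o) (w r : K) : 0 < r ->
  (lead_coef f).[x0] != 0 -> curve_eval f x0 w = 0 ->
  \forall x \near x0, exists2 v, curve_eval f x v = 0 & `|w - v| < r.
Proof.
move=> r0 a0 fw; set m := `|(lead_coef f).[x0]| / 2.
have m0 : 0 < m by rewrite divr_gt0 ?normr_gt0.
have cf : {for x0, continuous (fun x : K^o => curve_eval f x w : K^o)}.
  by apply: (@continuous_curve_eval _ f (fun=> w)); exact: cst_continuous.
near=> x.
have ax : m < `|(lead_coef f).[x]|.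
  near: x; apply: cvgr_norm_gt; first exact: horner_continuous.
  by rewrite /m ltr_pdivrMr// ltr_pMr ?normr_gt0// ltr1n.
have ax0 : (lead_coef f).[x] != 0 by rewrite -normr_gt0 (lt_trans m0).
have fx : `|curve_eval f x w| < m * r ^+ (size f).-1.
  near: x; apply: (cvgr_norm_lt _ cf).
  by rewrite fw normr0 mulr_gt0 ?exprn_gt0.
have [|v] := @exists_root_near _ (fiber f x) w r (ltW r0).
  rewrite fiber_horner lead_coef_fiber// size_fiber//; apply: lt_le_trans fx _.
  by rewrite ler_pM2r ?exprn_gt0// ltW.
by rewrite rootE fiber_horner => /eqP; exists v.
Unshelve. all: by end_near. Qed.

(** Y selects the only root in a fixed disc, over an open set U.  A root near
    Y x0 persists, it still lies in the disc, so it is Y x: this gives the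
    continuity that [implicit_derivable] asks for. *)
Lemma branch_derivable f (c r : K) (U : K^o -> Prop) (Y : K^o -> K^o) :
    (forall x0, U x0 -> \forall x \near x0, U x) ->
    (forall x, U x -> (lead_coef f).[x] != 0) ->
    (forall x, U x -> curve_eval f x (Y x) = 0 /\ `|c - Y x| < r) ->
    (forall x y, U x -> curve_eval f x y = 0 -> `|c - y| < r -> y = Y x) ->
    (forall x, U x -> curve_eval f^`() x (Y x) != 0) ->
  forall x0, U x0 -> derivable Y x0 1.
Proof.
move=> oU lead Yroot Yuniq fy x0 Ux0.
have [Yx0 cY] := Yroot _ Ux0.
apply: (@implicit_derivable _ f); last exact: fy.
  apply/(@cvgrPdist_lt K K^o _ _ (nbhs_filter x0)) => e e0.
  have s0 : 0 < r - `|c - Y x0| by rewrite subr_gt0.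
  (* Roots within m of Y x0 are within e of it and inside the disc around c. *)
  have [m [m0 me ms]] : exists m, [/\ 0 < m, m <= e & m <= r - `|c - Y x0|].
    have /orP[le|le] : (e <= r - `|c - Y x0|) || (r - `|c - Y x0| <= e).
    - by apply: real_leVge; exact: gtr0_real.
    - by exists e.
    - by exists (r - `|c - Y x0|).
  near=> x.
  have Ux : U x by near: x; exact: oU.
  have [v fv v_near] : exists2 v, curve_eval f x v = 0 & `|Y x0 - v| < m.
    by near: x; apply: root_persists => //; exact: lead.
  rewrite -(Yuniq x v)//; first exact: lt_le_trans me.
  rewrite -(subrK (Y x0) c) -addrA; apply: le_lt_trans (ler_normD _ _) _.
  by rewrite [X in X < _]addrC -ltrBrDr (lt_le_trans v_near).
by apply: filterS (oU _ Ux0) => x /Yroot[].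
Unshelve. all: by end_near. Qed.

End Branch.

(** * The closed formula for delta *)

Section Radius.
Variable K : numFieldType.
Implicit Types (eps x : K) (z : seq K) (f : {poly {poly K}}).

(** The inverse q of the radius r.  Taking q as a sum makes r smaller than the
    inverse of each term: r <= eps, and r <= |a - b| / 2 for a != b because
    2 / |d| <= 1 + 1 / |d| ^ 2.  The terms with a = b contribute 1, since the
    inverse of 0 is 0. *)
Definition inv_radius eps z : K :=
  1 + eps^-1 + \sum_(a <- z) \sum_(b <- z) (1 + (`|a - b| ^+ 2)^-1).

Lemma le_sum_mem (T : eqType) (s : seq T) (F : T -> K) c :
  (forall a, 0 <= F a) -> c \in s -> F c <= \sum_(a <- s) F a.
Proof. by move=> F0 cs; rewrite (big_rem c cs)/= lerDl sumr_ge0. Qed.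

Let term_ge0 (a b : K) : 0 <= 1 + (`|a - b| ^+ 2)^-1.
Proof. by rewrite addr_ge0 ?invr_ge0 ?exprn_ge0. Qed.

Let sum_ge0 z : 0 <= \sum_(a <- z) \sum_(b <- z) (1 + (`|a - b| ^+ 2)^-1).
Proof. by rewrite sumr_ge0// => a _; rewrite sumr_ge0. Qed.

Lemma inv_radius_gt0 eps z : 0 < eps -> 0 < inv_radius eps z.
Proof.
move=> e0; rewrite /inv_radius -addrA ltr_wpDr// addr_ge0 ?sum_ge0//.
by rewrite invr_ge0 ltW.
Qed.

Lemma radius_le eps z : 0 < eps -> (inv_radius eps z)^-1 <= eps.
Proof.
move=> e0; rewrite -[leRHS]invrK lef_pV2 ?posrE ?inv_radius_gt0 ?invr_gt0//.
by rewrite /inv_radius addrAC ler_wpDl// addr_ge0.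
Qed.

Lemma radius_separates eps z : 0 < eps ->
  {in z &, forall a b, a != b ->
    (inv_radius eps z)^-1 + (inv_radius eps z)^-1 <= `|a - b|}.
Proof.
move=> e0 a b az bz ab; have q0 := inv_radius_gt0 z e0.
have d0 : 0 < `|a - b| by rewrite normr_gt0 subr_eq0.
have dq : `|a - b|^-1 + `|a - b|^-1 <= inv_radius eps z.
  have := norm_double_le `|a - b|^-1; rewrite normfV normr_id exprVn.
  move=> /le_trans; apply; apply: le_trans (_ : _ <= \sum_(c <- z) _) _.
    exact: (le_sum_mem (F := fun c => 1 + (`|a - c| ^+ 2)^-1)).
  apply: le_trans (le_sum_mem (F := fun c =>
    \sum_(d <- z) (1 + (`|c - d| ^+ 2)^-1)) _ az) _.
    by move=> c; rewrite sumr_ge0.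
  by rewrite /inv_radius ler_wpDl// addr_ge0// invr_ge0 ltW.
rewrite -mulr2n -mulr_natl ler_pdivrMr// -ler_pdivrMl// mulrC mulr_natl.
by rewrite mulr2n.
Qed.

(** The factor 1 + 1 / |a_0(x1)| ^ 2 bounds 1 / |a_0(x1)|; the first majorant
    controls the variation of a_0, the sum controls the f(., c) scaled by
    r ^ -n.  The outer 1 keeps delta at most 1, as [majorantP] asks.  The leading
    coefficient is the last entry of f. *)
Definition delta_bound (f : seq (seq K)) x1 eps z : K :=
  (1 + (1 + (`|horner_rec (last [::] f) x1| ^+ 2)^-1) *
    (majorant x1 (last [::] f) +
     \sum_(c <- z) inv_radius eps z ^+ size z * majorant2 x1 f c))^-1.

Let total_ge0 (f : seq (seq K)) x1 eps z : 0 < eps ->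
  0 <= \sum_(c <- z) inv_radius eps z ^+ size z * majorant2 x1 f c.
Proof.
move=> e0; rewrite sumr_ge0// => c _.
by rewrite mulr_ge0 ?exprn_ge0 ?majorant2_ge0// ltW// inv_radius_gt0.
Qed.

Lemma delta_bound_gt0 (f : seq (seq K)) x1 eps z :
  0 < eps -> 0 < delta_bound f x1 eps z.
Proof.
move=> e0; rewrite invr_gt0 ltr_wpDr// mulr_ge0//.
by rewrite addr_ge0 ?majorant_ge0 ?total_ge0.
Qed.

Lemma last_polyseq f :
  last [::] [seq polyseq a | a <- f] = lead_coef f.
Proof.
rewrite -[X in last X _](polyseq0 K) (last_map (@polyseq K)).
by rewrite lead_coefE nth_last.
Qed.

(** By the choice of delta, |x - x1| times the whole bracket of [delta_bound] is
    less than |a_0(x1)|; the part of it that comes from a_0 pays for replacing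
    a_0(x1) by a_0(x). *)
Lemma lead_coef_dominates f x1 x eps z : 0 < eps ->
    (lead_coef f).[x1] != 0 ->
    `|x - x1| < delta_bound [seq polyseq a | a <- f] x1 eps z ->
  `|x - x1| * \sum_(c <- z) inv_radius eps z ^+ size z *
      majorant2 x1 [seq polyseq a | a <- f] c < `|(lead_coef f).[x]| /\
  `|x - x1| <= 1.
Proof.
move=> e0 a0; have a0' : 0 < `|(lead_coef f).[x1]| by rewrite normr_gt0.
rewrite /delta_bound last_polyseq -[horner_rec _ _]/((lead_coef f).[x1]).
set M := \sum_(c <- z) _; set N := majorant _ _; set I := 1 + _^-1.
have I0 : 0 < I by rewrite ltr_wpDr// invr_ge0 exprn_ge0.
have N0 : 0 <= N by exact: majorant_ge0.
have M0 : 0 <= M by exact: total_ge0.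
have IS0 : 0 <= I * (N + M) by rewrite mulr_ge0 ?addr_ge0// ltW.
have S1 : 0 < 1 + I * (N + M) by rewrite ltr_wpDr.
move=> dx; have {}dx : `|x - x1| * (1 + I * (N + M)) < 1.
  by rewrite -ltr_pdivlMr// mul1r.
have dx1 : `|x - x1| <= 1.
  by apply: le_trans (ltW dx); rewrite ler_peMr// lerDl.
split=> //.
have aI : 1 <= `|(lead_coef f).[x1]| * I.
  have := norm_le_add1sqr (lead_coef f).[x1]^-1; rewrite normfV exprVn => aI.
  by rewrite -ler_pdivrMl// mulr1.
have dNM : `|x - x1| * (N + M) < `|(lead_coef f).[x1]|.
  rewrite -(ltr_pM2r I0); apply: lt_le_trans aI; apply: le_lt_trans dx.
  by rewrite -mulrA [_ * I]mulrC ler_wpM2l// lerDr.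
have [_ aN] := majorantP (lead_coef f) dx1.
have : `|(lead_coef f).[x1]| <= `|(lead_coef f).[x]| + `|x - x1| * N.
  rewrite -[X in `|X| <= _](subrK (lead_coef f).[x]) [leRHS]addrC.
  apply: le_trans (ler_normD _ _) _.
  by rewrite lerD2r distrC.
move=> /(lt_le_trans dNM); rewrite mulrDr addrC.
by rewrite ltrD2r.
Qed.

End Radius.

(** * Branches over the whole disc of radius delta *)

Section BranchExistence.
Variable K : numClosedFieldType.
Implicit Types (f : {poly {poly K}}) (z : seq K).

(** The branch through c is the root in the disc of radius r around c, which
    [roots_matching] makes unique over every x with |x - x1| < d.  Its
    uniqueness is what identifies it with a given germ. *)
Lemma branch_exists f (x1 eps : K) z : 0 < eps ->
    (lead_coef f).[x1] != 0 -> size z = (size f).-1 -> uniq z ->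
    {in z, forall c, curve_eval f x1 c = 0} ->
  let d := delta_bound [seq polyseq a | a <- f] x1 eps z in
  forall c, c \in z -> exists Y : K^o -> K^o,
    (forall x, `|x - x1| < d ->
      [/\ derivable Y x 1, curve_eval f x (Y x) = 0 & `|c - Y x| < eps]) /\
    (exists2 r, 0 < r & forall x y, `|x - x1| < d ->
      curve_eval f x y = 0 -> `|c - y| < r -> y = Y x).
Proof.
move=> e0 a0 szz uz rz d c cz.
set q := inv_radius eps z; have q0 : 0 < q by exact: inv_radius_gt0.
have r0 : 0 < q^-1 by rewrite invr_gt0.
have lead x : `|x - x1| < d -> (lead_coef f).[x] != 0.
  move=> /(lead_coef_dominates e0 a0)[ax _]; rewrite -normr_gt0.
  apply: le_lt_trans ax; rewrite mulr_ge0// sumr_ge0// => b _.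
  by rewrite mulr_ge0 ?majorant2_ge0// exprn_ge0// ltW.
have small x : `|x - x1| < d -> {in z, forall a, `|(fiber f x).[a]| <
    `|lead_coef (fiber f x)| * q^-1 ^+ (size (fiber f x)).-1}.
  move=> xd a az; have [ax dx1] := lead_coef_dominates e0 a0 xd.
  rewrite lead_coef_fiber ?lead// size_fiber ?lead// -szz exprVn.
  rewrite ltr_pdivlMr ?exprn_gt0//; apply: le_lt_trans ax.
  have := majorant2P [seq polyseq b | b <- f] a dx1.
  have evE t : horner_rec [seq horner_rec b t | b <- [seq polyseq b | b <- f]] a
      = curve_eval f t a by rewrite -map_comp curve_evalE.
  rewrite !evE (rz a az) subr0 fiber_horner => fa.
  apply: le_trans (_ : _ <= `|x - x1| * majorant2 x1
    [seq polyseq b | b <- f] a * q ^+ size z) _.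
    by rewrite ler_wpM2r// exprn_ge0// ltW.
  rewrite -mulrA ler_wpM2l// mulrC.
  apply: (le_sum_mem (F := fun b => q ^+ size z * majorant2 x1 _ b)) az => b.
  by rewrite mulr_ge0 ?majorant2_ge0// exprn_ge0// ltW.
have sep := radius_separates (z := z) e0.
have fiber_neq0 x : `|x - x1| < d -> fiber f x != 0.
  by move=> /lead ax; rewrite -lead_coef_eq0 lead_coef_fiber.
have match_x x : `|x - x1| < d -> exists phi : K -> K,
    [/\ {in z, forall a, `|a - phi a| < q^-1},
    {in z, forall a b, root (fiber f x) b -> `|a - b| < q^-1 -> b = phi a} &
    coprimep (fiber f x) (fiber f x)^`()].
  move=> xd.
  apply: roots_matching (ltW r0) (fiber_neq0 _ xd) _ uz sep (small _ xd).
  by rewrite size_fiber ?lead.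
pose Y (x : K^o) : K^o :=
  xget c [set w | curve_eval f x w = 0 /\ `|c - w| < q^-1]%classic.
have YP x : `|x - x1| < d -> curve_eval f x (Y x) = 0 /\ `|c - Y x| < q^-1.
  move=> xd; rewrite /Y; case: xgetP => [w -> //|none].
  have [w rw cw] := exists_root_near (ltW r0) (small x xd c cz).
  by have [] := none w; split=> //; rewrite -fiber_horner; exact/rootP.
have Yuniq x y : `|x - x1| < d -> curve_eval f x y = 0 -> `|c - y| < q^-1 ->
    y = Y x.
  move=> xd fy cy; have [phi [_ phiP _]] := match_x x xd.
  have [fY cY] := YP x xd.
  transitivity (phi c); [|symmetry]; apply: (phiP c cz) => //.
    by rewrite rootE fiber_horner fy.
  by rewrite rootE fiber_horner fY.
exists Y; split; last by exists q^-1.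
move=> x xd; have [fY cY] := YP x xd; split=> //; last first.
  by apply: lt_le_trans cY _; exact: radius_le.
apply: (@branch_derivable _ f c q^-1 (fun x => `|x - x1| < d)) => // x0 x0d.
- exact: near_disc.
- have [phi [_ _ cop]] := match_x x0 x0d.
  rewrite -fiber_horner -deriv_fiber; apply: (coprimep_root cop).
  by rewrite rootE fiber_horner (YP x0 x0d).1.
Qed.

End BranchExistence.

(** * Functions computed by programs that always halt *)

Section Computable.
Variable R : realType.
Local Notation C := R[i].
Local Notation fn A B :=
  ((seq C -> seq C) -> interp C A -> interp C B).

(** Total functions only, and one program for all root finders: partiality is
    removed by extending inversion and root finding by a default value, after
    which no halting condition has to be carried along. *)
Definition computable (A B : ty) (F : fn A B) : Prop :=
  exists p : prog A B, forall rt x, computes rt p x (F rt x).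

Lemma computable_ext A B (F G : fn A B) :
  (forall rt x, F rt x = G rt x) -> computable F -> computable G.
Proof. by move=> FG [p pP]; exists p => rt x; rewrite -FG. Qed.

Lemma computable_id A : @computable A A (fun _ x => x).
Proof. by exists (Id A). Qed.

Lemma computable_comp A B D (F : fn A B) (G : fn B D) :
  computable F -> computable G -> computable (fun rt x => G rt (F rt x)).
Proof.
move=> [p pP] [q qP]; exists (Comp p q) => rt x.
by exists (F rt x).
Qed.

Lemma computable_pair E A B (u : fn E A) (v : fn E B) :
  computable u -> computable v ->
  @computable E (TProd A B) (fun rt e => (u rt e, v rt e)).
Proof. by move=> [p pP] [q qP]; exists (Fork p q) => rt x. Qed.

Lemma computable_fst E A B (u : fn E (TProd A B)) :
  computable u -> @computable E A (fun rt e => (u rt e).1).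
Proof.
move=> cu; apply: (@computable_comp _ (TProd A B) A _ (fun _ x => x.1) cu).
by exists (Fst A B).
Qed.

Lemma computable_snd E A B (u : fn E (TProd A B)) :
  computable u -> @computable E B (fun rt e => (u rt e).2).
Proof.
move=> cu; apply: (@computable_comp _ (TProd A B) B _ (fun _ x => x.2) cu).
by exists (Snd A B).
Qed.

Lemma computable_int E (k : int) : @computable E TNum (fun _ _ => k%:~R).
Proof. by exists (Const E k). Qed.

Lemma computable_add E (u v : fn E TNum) : computable u -> computable v ->
  @computable E TNum (fun rt e => u rt e + v rt e).
Proof.
move=> cu cv; apply: (@computable_comp _ (TProd TNum TNum) TNum _
  (fun _ x => x.1 + x.2) (computable_pair cu cv)).
by exists Add.
Qed.

Lemma computable_mul E (u v : fn E TNum) : computable u -> computable v ->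
  @computable E TNum (fun rt e => u rt e * v rt e).
Proof.
move=> cu cv; apply: (@computable_comp _ (TProd TNum TNum) TNum _
  (fun _ x => x.1 * x.2) (computable_pair cu cv)).
by exists Mul.
Qed.

Lemma computable_opp E (u : fn E TNum) : computable u ->
  @computable E TNum (fun rt e => - u rt e).
Proof.
move=> cu; apply: (@computable_comp _ TNum TNum _ (fun _ x => - x) cu).
by exists Opp.
Qed.

(** |z| ^ 2 = z * z^* avoids the square root in the norm. *)
Lemma computable_sqr_norm E (u : fn E TNum) : computable u ->
  @computable E TNum (fun rt e => `|u rt e| ^+ 2).
Proof.
move=> cu; have cc : computable (fun rt e => (u rt e)^* : interp C TNum).
  by apply: (@computable_comp _ TNum TNum _ (fun _ x => x^*) cu); exists Conj.
by apply: computable_ext (computable_mul cu cc) => rt e; rewrite sqr_normc.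
Qed.

Lemma Re_le0 (w : C) : 0 <= w -> (complex.Re w <= complex.Re 0) = (w == 0).
Proof.
case: w => a b; rewrite lecE/= => /andP[/eqP-> a0].
by rewrite eq_complex/= eqxx andbT eq_le a0 andbT.
Qed.

(** The language compares real parts only; |z| ^ 2 <= 0 tests z = 0. *)
Lemma computable_eq0 E (u : fn E TNum) : computable u ->
  @computable E TBool (fun rt e => u rt e == 0).
Proof.
move=> /computable_sqr_norm cu.
have cle : @computable (TProd TNum TNum) TBool
    (fun _ x => complex.Re x.1 <= complex.Re x.2) by exists Le.
have := computable_comp (computable_pair cu (computable_int _ 0)) cle.
apply: computable_ext => rt e.
by rewrite -[RHS]normr_eq0 -[RHS]sqrf_eq0; apply: Re_le0; rewrite exprn_ge0.
Qed.

(** For an operation that is undefined on some inputs: the program q has to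
    halt only where the test fails. *)
Lemma computable_guard E B (c : fn E TBool) (u v : fn E B) (q : prog E B) :
  computable c -> computable u ->
  (forall rt e, ~~ c rt e -> computes rt q e (v rt e)) ->
  @computable E B (fun rt e => if c rt e then u rt e else v rt e).
Proof.
move=> [t tP] [p pP] qP; exists (If t p q) => rt e /=; exists (c rt e) => //.
by case c1: (c rt e); [exact: pP|apply: qP; rewrite c1].
Qed.

Lemma computable_inv E (u : fn E TNum) : computable u ->
  @computable E TNum (fun rt e => (u rt e)^-1).
Proof.
move=> cu; have [p pP] := cu.
have invP (rt : seq C -> seq C) e : u rt e != 0 ->
  computes rt (Comp p Defs.Inv) e ((u rt e)^-1 : interp C TNum).
  by move=> u0; exists (u rt e).
have := @computable_guard _ TNum _ _ (fun rt e => (u rt e)^-1) _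
  (computable_eq0 cu) (computable_int _ 0) invP.
by apply: computable_ext => rt e; case: eqP => // ->; rewrite invr0.
Qed.

Lemma computable_nil E A : @computable E (TList A) (fun _ _ => [::]).
Proof. by exists (Defs.Nil E A). Qed.

Lemma computable_cons E A (u : fn E A) (s : fn E (TList A)) :
  computable u -> computable s ->
  @computable E (TList A) (fun rt e => u rt e :: s rt e).
Proof.
move=> cu cs; apply: (@computable_comp _ (TProd A (TList A)) (TList A) _
  (fun _ x => x.1 :: x.2) (computable_pair cu cs)).
by exists (Defs.Cons A).
Qed.

(** The only use of an unbounded loop.  The state is (environment, accumulator,
    remaining list), so the loop halts when the list is exhausted. *)
Lemma computable_foldl E A S
    (step : (seq C -> seq C) -> interp C E -> interp C S -> interp C A ->
      interp C S)
    (init : fn E S) (s : fn E (TList A)) :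
  @computable (TProd E (TProd S A)) S (fun rt x => step rt x.1 x.2.1 x.2.2) ->
  computable init -> computable s ->
  @computable E S (fun rt e => foldl (step rt e) (init rt e) (s rt e)).
Proof.
move=> [p pP] [i iP] [l lP].
pose T := TProd (TProd E S) (TList A).
pose env : prog (TProd (TProd E S) (TProd A (TList A))) E :=
  Comp (Fst _ _) (Fst _ _).
pose acc : prog (TProd (TProd E S) (TProd A (TList A))) S :=
  Comp (Fst _ _) (Snd _ _).
pose hd : prog (TProd (TProd E S) (TProd A (TList A))) A :=
  Comp (Snd _ _) (Fst _ _).
pose tl : prog (TProd (TProd E S) (TProd A (TList A))) (TList A) :=
  Comp (Snd _ _) (Snd _ _).
pose next : prog (TProd (TProd E S) (TProd A (TList A))) T :=
  Fork (Fork env (Comp (Fork env (Fork acc hd)) p)) tl.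
pose body : prog T T := Case (Fork (Id _) (Defs.Nil _ _)) next.
(* The language has no boolean constants: 1 <= 0 and 0 <= 1 stand for them. *)
pose cmp D a b : prog D TBool := Comp (Fork (Const D a) (Const D b)) Le.
pose test : prog T TBool := Case (cmp _ 1 0) (cmp _ 0 1).
have cmpP (rt : seq C -> seq C) D a b x :
    computes rt (cmp D a b) x
      (complex.Re (a%:~R : C) <= complex.Re (b%:~R : C)).
  by exists (a%:~R, b%:~R) => //; split.
have loopP (rt : seq C -> seq C) e z t :
    loop (computes rt test) (computes rt body) (e, z, t)
      (e, foldl (step rt e) z t, [::]).
  elim: t z => [|h t IH] z /=.
    apply: loop_stop => /=; have := cmpP rt (TProd E S) 1 0 (e, z).
    by rewrite /= ler10.
  apply: (loop_step (y := (e, step rt e z h, t))) => //.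
    have := cmpP rt (TProd (TProd E S) (TProd A (TList A))) 0 1
      ((e, z), (h, t)).
    by rewrite /= ler01.
  split=> /=; last by exists (h, t).
  split=> /=; first by exists (e, z).
  exists (e, (z, h)); last exact: (pP rt (e, (z, h))).
  by split=> /=; [exists (e, z)|split; [exists (e, z)|exists (h, t)]].
exists (Comp (Comp (Fork (Fork (Id E) i) l) (While test body))
  (Comp (Fst _ _) (Snd _ _))) => rt e.
exists (e, foldl (step rt e) (init rt e) (s rt e), [::]) => /=.
  exists (e, init rt e, s rt e); last exact: loopP.
  by split=> /=; [split=> //=; exact: iP|exact: lP].
by exists (e, foldl (step rt e) (init rt e) (s rt e)).
Qed.

Lemma computable_env E A B (u : fn E A) :
  computable u -> @computable (TProd E B) A (fun rt x => u rt x.1).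
Proof. exact: (computable_comp (computable_fst (computable_id _))). Qed.

Lemma computable_rev E A (s : fn E (TList A)) :
  computable s -> @computable E (TList A) (fun rt e => rev (s rt e)).
Proof.
move=> cs; apply: computable_ext (computable_foldl
  (step := fun _ _ (t : interp C (TList A)) a => a :: t)
  _ (computable_nil _ _) cs) => [rt e|].
  have -> : foldl (fun t a => a :: t) [::] (s rt e) =
    foldl (fun t a => a :: t) [::] (rev (rev (s rt e))) by rewrite revK.
  by rewrite foldl_rev; elim: (rev _) => //= a t ->.
have cx := computable_snd (computable_id (TProd E (TProd (TList A) A))).
exact: computable_cons (computable_snd cx) (computable_fst cx).
Qed.

Lemma computable_foldr E A S
    (step : (seq C -> seq C) -> interp C E -> interp C A -> interp C S ->
      interp C S)
    (init : fn E S) (s : fn E (TList A)) :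
  @computable (TProd E (TProd S A)) S (fun rt x => step rt x.1 x.2.2 x.2.1) ->
  computable init -> computable s ->
  @computable E S (fun rt e => foldr (step rt e) (init rt e) (s rt e)).
Proof.
move=> cstep cinit /computable_rev cs.
apply: computable_ext (computable_foldl (step := fun rt e z a => step rt e a z)
  cstep cinit cs) => rt e.
exact: foldl_rev.
Qed.

Lemma computable_map E A B
    (h : (seq C -> seq C) -> interp C E -> interp C A -> interp C B)
    (s : fn E (TList A)) :
  @computable (TProd E A) B (fun rt x => h rt x.1 x.2) -> computable s ->
  @computable E (TList B) (fun rt e => [seq h rt e a | a <- s rt e]).
Proof.
move=> ch cs; have cx := computable_id (TProd E (TProd (TList B) A)).
have cea := computable_pair (computable_fst cx)
  (computable_snd (computable_snd cx)).
have cstep : @computable (TProd E (TProd (TList B) A)) (TList B)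
    (fun rt x => h rt x.1 x.2.2 :: x.2.1).
  exact: computable_cons (computable_comp cea ch)
    (computable_fst (computable_snd cx)).
exact: (@computable_foldr E A (TList B) (fun rt e a t => h rt e a :: t)
  _ s cstep (computable_nil _ _) cs).
Qed.

Lemma computable_sum E A
    (h : (seq C -> seq C) -> interp C E -> interp C A -> interp C TNum)
    (s : fn E (TList A)) :
  @computable (TProd E A) TNum (fun rt x => h rt x.1 x.2) -> computable s ->
  @computable E TNum (fun rt e => \sum_(a <- s rt e) h rt e a).
Proof.
move=> ch cs; have cx := computable_id (TProd E (TProd TNum A)).
have cea := computable_pair (computable_fst cx)
  (computable_snd (computable_snd cx)).
have cstep : @computable (TProd E (TProd TNum A)) TNum
    (fun rt x => h rt x.1 x.2.2 + x.2.1).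
  exact: computable_add (computable_comp cea ch)
    (computable_fst (computable_snd cx)).
have := @computable_foldr E A TNum (fun rt e a t => h rt e a + t)
  _ s cstep (computable_int _ 0) cs.
apply: computable_ext => rt e.
by elim: (s rt e) => [|a t IH]; rewrite ?big_nil// big_cons -IH.
Qed.

Lemma computable_horner_rec E (s : fn E (TList TNum)) (u : fn E TNum) :
  computable s -> computable u ->
  @computable E TNum (fun rt e => horner_rec (s rt e) (u rt e)).
Proof.
move=> cs cu.
have cx := computable_snd (computable_id (TProd E (TProd TNum TNum))).
have cstep : @computable (TProd E (TProd TNum TNum)) TNum
    (fun rt x => x.2.1 * u rt x.1 + x.2.2).
  exact: computable_add
    (computable_mul (computable_fst cx) (computable_env _ cu))
    (computable_snd cx).
have := @computable_foldr E TNum TNum (fun rt e a t => t * u rt e + a)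
  _ s cstep (computable_int _ 0) cs.
apply: computable_ext => rt e.
by elim: (s rt e) => //= a t ->.
Qed.

Lemma computable_last E A (s : fn E (TList A)) (u : fn E A) :
  computable s -> computable u ->
  @computable E A (fun rt e => last (u rt e) (s rt e)).
Proof.
move=> cs cu; have cx := computable_snd (computable_id (TProd E (TProd A A))).
have := @computable_foldl _ A A (fun _ _ _ a => a) _ s
  (computable_snd cx) cu cs.
apply: computable_ext => rt e.
by elim: (s rt e) (u rt e) => //= a t IH b.
Qed.

Lemma computable_expr_size E A (s : fn E (TList A)) (u : fn E TNum) :
  computable s -> computable u ->
  @computable E TNum (fun rt e => u rt e ^+ size (s rt e)).
Proof.
move=> cs cu.
have cx := computable_snd (computable_id (TProd E (TProd TNum A))).
have cstep : @computable (TProd E (TProd TNum A)) TNum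
    (fun rt x => u rt x.1 * x.2.1).
  exact: computable_mul (computable_env _ cu) (computable_fst cx).
have := @computable_foldr E A TNum (fun rt e a t => u rt e * t)
  _ s cstep (computable_int _ 1) cs.
apply: computable_ext => rt e.
by elim: (s rt e) => [|a t IH] /=; rewrite ?expr0// exprS -IH.
Qed.

Lemma Poly_eq0 (s : seq C) : (Poly s == 0) = (\sum_(c <- s) `|c| ^+ 2 == 0).
Proof.
rewrite psumr_eq0 => [|c _]; last by rewrite exprn_ge0.
apply/eqP/allP => [s0 c /(nthP 0)[i _ <-]|s0].
  by rewrite /= -coef_Poly s0 coef0 normr0 expr0n eqxx.
apply/polyP => i; rewrite coef_Poly coef0.
have [lti|/(nth_default 0)//] := ltnP i (size s).
by have := s0 _ (mem_nth 0 lti); rewrite /= expf_eq0/= normr_eq0 => /eqP.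
Qed.

Lemma computable_roots E (s : fn E (TList TNum)) : computable s ->
  @computable E (TList TNum)
    (fun rt e => if Poly (s rt e) == 0 then [::] else rt (s rt e)).
Proof.
move=> cs; have [p pP] := cs.
have csum :
    computable (fun rt e => \sum_(c <- s rt e) `|c| ^+ 2 : interp C TNum).
  apply: (computable_sum (h := fun _ _ (c : interp C TNum) => `|c| ^+ 2)) => //.
  exact: computable_sqr_norm (computable_snd (computable_id _)).
have rootsP (rt : seq C -> seq C) e : (\sum_(c <- s rt e) `|c| ^+ 2 != 0) ->
    computes rt (Comp p Roots) e (rt (s rt e)).
  by rewrite -Poly_eq0 => s0; exists (s rt e).
have := @computable_guard _ (TList TNum) _ _ (fun rt e => rt (s rt e)) _
  (computable_eq0 csum) (computable_nil _ _) rootsP.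
by apply: computable_ext => rt e; rewrite Poly_eq0.
Qed.

Lemma computable_add1sqr E (u : fn E TNum) : computable u ->
  @computable E TNum (fun rt e => 1 + `|u rt e| ^+ 2).
Proof.
move=> cu.
exact: computable_add (computable_int _ 1) (computable_sqr_norm cu).
Qed.

Lemma computable_majorant E (u : fn E TNum) (s : fn E (TList TNum)) :
  computable u -> computable s ->
  @computable E TNum (fun rt e => majorant (u rt e) (s rt e)).
Proof.
move=> cu cs; apply: computable_horner_rec.
  apply: (@computable_map _ TNum TNum (fun _ _ c => 1 + `|c| ^+ 2)) cs.
  exact: computable_add1sqr (computable_snd (computable_id _)).
exact: computable_add (computable_int _ 1) (computable_add1sqr cu).
Qed.
Lemma computable_majorant2 E (u v : fn E TNum)
    (s : fn E (TList (TList TNum))) :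
  computable u -> computable s -> computable v ->
  @computable E TNum (fun rt e => majorant2 (u rt e) (s rt e) (v rt e)).
Proof.
move=> cu cs cv; apply: computable_horner_rec (computable_add1sqr cv).
apply: (@computable_map _ (TList TNum) TNum
  (fun rt e a => majorant (u rt e) a)) cs.
exact: computable_majorant (computable_env _ cu)
  (computable_snd (computable_id _)).
Qed.

Lemma computable_inv_radius E (u : fn E TNum) (s : fn E (TList TNum)) :
  computable u -> computable s ->
  @computable E TNum (fun rt e => inv_radius (u rt e) (s rt e)).
Proof.
move=> cu cs; apply: computable_add.
  exact: computable_add (computable_int _ 1) (computable_inv cu).
apply: (@computable_sum _ TNum (fun rt e a =>
  \sum_(b <- s rt e) (1 + (`|a - b| ^+ 2)^-1))) (cs).
apply: (@computable_sum _ TNum (fun rt (e : interp C (TProd E TNum)) b =>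
  1 + (`|e.2 - b| ^+ 2)^-1)) (computable_env _ cs).
have cx := computable_id (TProd (TProd E TNum) TNum).
apply: (computable_add (computable_int _ 1)); apply: computable_inv.
apply: computable_sqr_norm; apply: computable_add.
  exact: computable_snd (computable_fst cx).
exact: computable_opp (computable_snd cx).
Qed.

Lemma computable_delta_bound E (fs : fn E (TList (TList TNum)))
    (u v : fn E TNum) (s : fn E (TList TNum)) :
  computable fs -> computable u -> computable v -> computable s ->
  @computable E TNum
    (fun rt e => delta_bound (fs rt e) (u rt e) (v rt e) (s rt e)).
Proof.
move=> cfs cu cv cs.
have cl := computable_last cfs (computable_nil _ _).
apply: computable_inv; apply: (computable_add (computable_int _ 1)).
apply: computable_mul.
  apply: (computable_add (computable_int _ 1)); apply: computable_inv.
  exact: computable_sqr_norm (computable_horner_rec cl cu).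
apply: (computable_add (computable_majorant cu cl)).
apply: (@computable_sum _ TNum (fun rt e c =>
  inv_radius (v rt e) (s rt e) ^+ size (s rt e) *
  majorant2 (u rt e) (fs rt e) c)) (cs).
have env A (w : fn E A) : computable w ->
    @computable (TProd E TNum) A (fun rt x => w rt x.1).
  exact: computable_env.
apply: computable_mul.
  exact: (@computable_expr_size _ TNum _ _ (env _ _ cs)
    (computable_inv_radius (env _ _ cv) (env _ _ cs))).
exact: computable_majorant2 (env _ _ cu) (env _ _ cfs)
  (computable_snd (computable_id _)).
Qed.

(** * The algorithm and its correctness *)

Definition base_roots (rt : seq C -> seq C) (fs : seq (seq C)) (x1 : C) :
    seq C :=
  let s := [seq horner_rec a x1 | a <- fs] in
  if Poly s == 0 then [::] else rt s.

Definition delta_algorithm (rt : seq C -> seq C)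
    (x : interp C (TProd (TList (TList TNum)) (TProd TNum TNum))) : C :=
  delta_bound x.1 x.2.1 x.2.2 (base_roots rt x.1 x.2.1).

Lemma computable_delta_algorithm :
  @computable (TProd (TList (TList TNum)) (TProd TNum TNum)) TNum
    delta_algorithm.
Proof.
have cx := @computable_id (TProd (TList (TList TNum)) (TProd TNum TNum)).
have cx1 := computable_fst (computable_snd cx).
apply: (computable_delta_bound (computable_fst cx) cx1).
  exact: computable_snd (computable_snd cx).
apply: computable_roots.
apply: (@computable_map (TProd (TList (TList TNum)) (TProd TNum TNum))
  (TList TNum) TNum (fun _ x a => horner_rec a x.2.1)) (computable_fst cx).
exact: computable_horner_rec (computable_snd (computable_id _))
  (computable_env _ cx1).
Qed.

Lemma base_rootsP (rt : seq C -> seq C) (f : {poly {poly C}}) (x1 : C) :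
    root_finder rt -> (lead_coef f).[x1] != 0 ->
    (discriminant_y f).[x1] != 0 ->
  let z := base_roots rt [seq polyseq a | a <- f] x1 in
  [/\ size z = (size f).-1, uniq z &
    forall c, (c \in z) = (curve_eval f x1 c == 0)].
Proof.
move=> rtP a0 disc z.
have fibE : Poly [seq horner_rec a x1 | a <- [seq polyseq a | a <- f]]
    = fiber f x1 by rewrite fiberE -map_comp.
have fib0 : fiber f x1 != 0 by rewrite -lead_coef_eq0 lead_coef_fiber.
have zE : fiber f x1 = lead_coef (fiber f x1) *: \prod_(c <- z) ('X - c%:P).
  by rewrite /z /base_roots -fibE in fib0 *; rewrite (negPf fib0); exact: rtP.
have szz : size z = (size f).-1.
  rewrite -(size_fiber a0) zE size_scale ?lead_coef_eq0//.
  by rewrite size_prod_XsubC.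
split=> // [|c]; last first.
  by rewrite -fiber_horner -rootE zE rootZ ?lead_coef_eq0// root_prod_XsubC.
have [sz|sz] := ltnP 1 (size f).
  have := fiber_separable sz a0 disc.
  rewrite zE derivZ coprimepZl ?coprimepZr ?lead_coef_eq0// => cop.
  by rewrite -separable_prod_XsubC unlock.
by move: szz; case: (z) => [|a [|b t]]//=; case: (size f) sz => [|[]].
Qed.

(** The order of R[i] makes every positive element real. *)
Lemma complex_gt0 (w : C) : 0 < w -> exists2 d : R, w = d%:C & 0 < d.
Proof. by case: w => a b; rewrite ltcE/= => /andP[/eqP-> a0]; exists a. Qed.

End Computable.

Theorem theorem2p1 (R : realType) :
  exists P : prog (TProd (TList (TList TNum)) (TProd TNum TNum)) TNum,
  forall rt : seq R[i] -> seq R[i], root_finder rt ->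
  forall (f : {poly {poly R[i]}}) (x1 : R[i]) (eps : R),
    (lead_coef f).[x1] != 0 ->
    (discriminant_y f).[x1] != 0 ->
    0 < eps ->
    exists delta : R,
      [/\ computes rt P ([seq polyseq a | a <- polyseq f], (x1, eps%:C)) delta%:C,
          0 < delta &
          forall y : R[i] -> R[i],
            holomorphic_near y x1 ->
            (\forall x \near (x1 : R[i]^o), curve_eval f x (y x) = 0) ->
            forall x2 : R[i], `|x1 - x2| < delta%:C ->
              exists2 g : R -> R[i] -> R[i],
                analytic_continuation (segment x1 x2) y g &
                `|y x1 - g 1 x2| < eps%:C].
Proof.
have [P PP] := computable_delta_algorithm R; exists P.
move=> rt rtP f x1 eps a0 disc eps0.
have e0 : 0 < eps%:C by rewrite ltcR.
set fs := [seq polyseq a | a <- f].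
have [szz uz zP] := base_rootsP rtP a0 disc.
have [delta dE d0] := complex_gt0
  (delta_bound_gt0 fs x1 (base_roots rt fs x1) e0).
exists delta; split=> //.
  by rewrite -dE; exact: (PP rt (fs, (x1, eps%:C))).
move=> y yhol yroot x2 x2d.
have yx1 : y x1 \in base_roots rt fs x1.
  by rewrite zP; apply/eqP; exact: nbhs_singleton yroot.
have rz : {in base_roots rt fs x1, forall c, curve_eval f x1 c = 0}.
  by move=> c; rewrite zP => /eqP.
have [Y [YP [r r0 Yuniq]]] := branch_exists e0 a0 szz uz rz yx1.
rewrite -/fs dE in YP Yuniq.
have seg_d t : 0 <= t <= 1 -> `|segment x1 x2 t - x1| < delta%:C.
  move=> /andP[t0 t1]; rewrite /segment addrC addKr normrM.
  apply: le_lt_trans x2d; rewrite distrC ler_piMl//.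
  by rewrite ger0_norm ?lecR.
(* One function on the whole disc represents all germs along the segment. *)
exists (fun=> Y).
  split.
  - rewrite /same_germ /segment mul0r addr0.
    have cy : {for (x1 : R[i]^o), continuous (y : R[i]^o -> R[i]^o)}.
      apply: differentiable_continuous; apply/derivable1_diffP.
      exact: nbhs_singleton yhol.
    have x1d : `|x1 - x1| < delta%:C by rewrite subrr normr0 ltcR.
    have y_near := @cvgr_dist_lt _ R[i]^o _ _ (nbhs_filter (x1 : R[i]^o)) y _
      cy r r0.
    near=> x; apply/esym/Yuniq.
    + by near: x; exact: near_disc.
    + by near: x; exact: yroot.
    + by near: x; exact: y_near.
  - move=> t /seg_d/near_disc; apply: filterS => x xd.
    by have [] := YP x xd.
  - move=> t _; apply: (@filterE _ _ (nbhs_filter t)) => s _.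
    exact: (@filterE _ _ (nbhs_filter (segment x1 x2 s : R[i]^o))).
by have [] := YP x2 _; rewrite // distrC.
Unshelve. all: by end_near. Qed.
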